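(* Let $D$ be a discrete space of infinite cardinality $\kappa$ and $\mathcal{I}$ an ideal on $\mathbb{N}$. The following assertions are equivalent: (1) $\mathcal{I}$ is a Baire ideal for every complete metric space $X$ with weight $w(X)\leq\kappa$. (2) $\mathcal{I}$ is a Baire ideal for $D^{\mathbb{N}}$ (with the product topology). (3) For every monotonic $f\colon D^{<\mathbb{N}}\to\mathcal{P}(\mathcal{I})$ such that for every $s\in D^{<\mathbb{N}}$: (i) $f(s)$ is hereditary, and (ii) $\mathcal{I}=\bigcup_{t\succcurlyeq s}f(t)$, there exists $\sigma\in D^{\mathbb{N}}$ such that $\bigcup_{k\in\mathbb{N}}f(\sigma|_k)=\mathcal{I}$. (4) For every monotonic $f\colon D^{<\mathbb{N}}\to\mathcal{P}(\mathcal{I})$ such that for every $s\in D^{<\mathbb{N}}$: (i) $f(s)$ is hereditary, (ii') $\mathcal{I}=\bigcup_{d\in D}f(s^\frown d)$, and (iii) $f(s)=\bigcap_{d\in D}f(s^\frown d)$, there exists $\sigma\in D^{\mathbb{N}}$ such that $\bigcup_{k\in\mathbb{N}}f(\sigma|_k)=\mathcal{I}$.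
   Context: An ideal on $\mathbb{N}$ is a family $\mathcal{I}\subset\mathcal{P}(\mathbb{N})$ with $\mathbb{N}\notin\mathcal{I}$, closed under subsets and finite unions; every ideal is assumed to contain the family of all finite subsets of $\mathbb{N}$. For a topological space $X$, $\mathrm{NWD}(X)$ is the family of nowhere dense subsets of $X$. $\mathcal{I}$ is a Baire ideal for $X$ if for every monotonic $F\colon\mathcal{I}\to\mathrm{NWD}(X)$ (i.e. $A\subset B$ implies $F(A)\subset F(B)$) one has $\bigcup\{F(A):A\in\mathcal{I}\}\neq X$. Metric spaces are assumed nonempty. The weight $w(X)$ is the least cardinality of a basis of open sets of $X$. $D^{<\mathbb{N}}$ is the set of finite sequences of elements of $D$ (including the empty one); for $\sigma\in D^{\mathbb{N}}$, $\sigma|_0=\emptyset$ and $\sigma|_k=(\sigma(1),\dots,\sigma(k))$ for $k>0$; $s\preccurlyeq t$ (equivalently $t\succcurlyeq s$) means that $t$ extends $s$ (possibly $t=s$); $s^\frown d$ is the sequence obtained by adding $d$ at the end of $s$. A map $f\colon D^{<\mathbb{N}}\to\mathcal{P}(\mathcal{I})$ is monotonic if $s\preccurlyeq t$ implies $f(s)\subset f(t)$. A family $\mathcal{A}\subset\mathcal{P}(\mathbb{N})$ is hereditary if $B\subset A\in\mathcal{A}$ implies $B\in\mathcal{A}$. *)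

(* Defs.v *)
From HB Require Import structures.
From mathcomp Require Import all_boot all_order all_algebra.
From mathcomp Require Import all_classical all_reals all_analysis.

Set Implicit Arguments.
Unset Strict Implicit.
Unset Printing Implicit Defensive.

Local Open Scope classical_set_scope.
Local Open Scope card_scope.

(* [Complete] includes a distinguished point, so these spaces are nonempty. *)
#[short(type="completeMetricType")]
HB.structure Definition CompleteMetric (R : numDomainType) :=
  {T of Metric R T & Complete T}.

Definition hereditary (A : set (set nat)) : Prop :=
  forall a b : set nat, b `<=` a -> A a -> A b.

Record ideal (I : set (set nat)) : Prop := Ideal {
  ideal_proper : ~ I [set: nat];
  ideal_hereditary : hereditary I;
  ideal_setU : forall a b : set nat, I a -> I b -> I (a `|` b);
  ideal_finite : forall a : set nat, finite_set a -> I a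
}.

Definition nowhere_dense (X : topologicalType) (A : set X) : Prop :=
  interior (closure A) = set0.

(* A map on the ideal I is a total function on [set nat] whose values outside I
   are unconstrained and never used. *)
Definition baire_ideal (I : set (set nat)) (X : topologicalType) : Prop :=
  forall F : set nat -> set X,
    (forall a, I a -> nowhere_dense (F a)) ->
    (forall a b, I a -> I b -> a `<=` b -> F a `<=` F b) ->
    \bigcup_(a in I) F a <> [set: X].

(* A basis of cardinality w(X). *)
Definition least_basis (X : topologicalType) (B : set (set X)) : Prop :=
  basis B /\ forall B' : set (set X), basis B' -> B #<= B'.

(* w(X) <= #|K| *)
Definition weight_le (X : topologicalType) (K : Type) : Prop :=
  exists2 B : set (set X), least_basis B & B #<= [set: K].

(* A monotonic map from the finite sequences over D to the powerset of I. *)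
Definition monotonic_into (D : eqType) (I : set (set nat))
    (f : seq D -> set (set nat)) : Prop :=
  (forall s, f s `<=` I) /\ (forall s t, prefix s t -> f s `<=` f t).

(* [mkseq sigma k] is the restriction of sigma to its first k terms. *)
Definition branch_covers (D : Type) (I : set (set nat))
    (f : seq D -> set (set nat)) (sigma : nat -> D) : Prop :=
  \bigcup_k f (mkseq sigma k) = I.

(* Main.v *)
(* The map F(A) = {x : A not in f(x|k) for every k} on D^N is monotone with nowhere
   dense values as soon as f is as in (3), so a point outside all the F(A) is a branch
   of f covering I. Conversely, given F on a complete metric space X, build a tree U_s
   of open sets, with U_s the union of the U_(s^d) and the U_(s^d) forming a pi-base
   of U_s by sets of small diameter whose closure is in U_s. Then
   f(s) = {A in I : U_s disjoint from F(A)} is as in (4), and for a branch sigma of f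
   covering I the sets U_(sigma|k) meet in a point outside all the F(A).
   That D^N itself is completely metrizable of weight at most |D| rests on
   |D^(<N)| = |D|, which Zorn's lemma gives. *)
Require Import Defs.
From HB Require Import structures.
From mathcomp Require Import all_boot all_order all_algebra.
From mathcomp Require Import all_classical all_reals all_analysis.
Import Order.TTheory GRing.Theory Num.Theory.

Local Open Scope classical_set_scope.

(** * Cardinality of the set of finite sequences *)

(** By the uniqueness hypothesis the converse of [r] is a partial function; extended by the constant
    [x0], it maps [B] onto a superset of [A]. *)
Lemma card_le_rel {T U : Type} (A : set T) (B : set U) (r : T -> U -> Prop) :
  (forall x, A x -> exists2 y, B y & r x y) ->
  (forall x x' y, A x -> A x' -> r x y -> r x' y -> x = x') ->
  (A #<= B)%card.
Proof.
move=> rAB r_inj; have [->|/set0P[x0 _]] := eqVneq A set0; first exact: card_ge0.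
have /choice[g gP] y : exists x, forall x', A x' -> r x' y -> x = x'.
  have [[x [Ax rxy]]|nr] := pselect (exists x, A x /\ r x y).
    by exists x => x' Ax' rx'y; exact: r_inj rxy rx'y.
  by exists x0 => x' Ax' rx'y; case: nr; exists x'.
apply: (card_le_trans _ (card_image_le g B)).
apply: subset_card_le => x Ax; have [y By rxy] := rAB x Ax.
by exists y => //; exact: gP.
Qed.

Lemma card_le_surj {T U : Type} {A : set T} {B : set U} :
  A !=set0 -> (A #<= B)%card ->
  exists g : U -> T, forall x, A x -> exists2 y, B y & g y = x.
Proof.
move=> [x0 Ax0] /pfcard_geP[A0|[g]]; first by rewrite A0 in Ax0.
by exists g => x Ax; have [y By <-] := @surj _ _ _ _ g x Ax; exists y.
Qed.

(** Zorn on partial bijections between [A] and [B]: a maximal one exhausts one of the two sides,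
    since otherwise a pair of unmatched points could be added. *)
Lemma card_le_total {T U : Type} (A : set T) (B : set U) :
  (A #<= B)%card \/ (B #<= A)%card.
Proof.
pose P (G : set (T * U)) := G `<=` A `*` B /\
  forall x y x' y', G (x, y) -> G (x', y') -> x = x' <-> y = y'.
have [|G [[GAB Ginj] Gmax]] := @Zorn_bigcup _ P.
  move=> F FP Ftot; split=> [p [G /FP[GAB _]]|x y x' y' [G FG Gxy] [G' FG' Gxy']].
    exact: GAB.
  have [/(_ _ Gxy)|/(_ _ Gxy')] := Ftot _ _ FG FG'.
    by move=> G'xy; exact: (FP _ FG').2.
  by move=> G'xy; exact: (FP _ FG).2.
have [AG|/existsNP[a /not_implyP[Aa aG]]] :=
    pselect (forall x, A x -> exists y, G (x, y)).
  left; apply: (card_le_rel _ _ (fun x y => G (x, y))).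
    by move=> x /AG[y Gxy]; exists y => //; have [] := GAB _ Gxy.
  by move=> x x' y _ _ Gxy Gxy'; apply/(Ginj _ _ _ _ Gxy Gxy').
have [BG|/existsNP[b /not_implyP[Bb bG]]] :=
    pselect (forall y, B y -> exists x, G (x, y)).
  right; apply: (card_le_rel _ _ (fun y x => G (x, y))).
    by move=> y /BG[x Gxy]; exists x => //; have [] := GAB _ Gxy.
  by move=> y y' x _ _ Gxy Gxy'; apply/(Ginj _ _ _ _ Gxy Gxy').
exfalso; apply: (Gmax (G `|` [set (a, b)])).
  split; first by left.
  by move=> sub; apply: aG; exists b; apply: sub; right.
split=> [p [/GAB//|->]//|x y x' y' [Gxy|[-> ->]] [Gxy'|[-> ->]]//].
- exact: Ginj.
- by split=> E; [case: aG|case: bG]; [exists y; rewrite -E|exists x; rewrite -E].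
- by split=> E; [case: aG|case: bG]; [exists y'; rewrite E|exists x'; rewrite E].
Qed.

Definition seqs_on {T : eqType} (A : set T) : set (seq T) :=
  [set s | forall a, a \in s -> A a].

Lemma seqs_on_map_surj {T U : eqType} (f : T -> U) (A : set T) (B : set U) :
  (forall y, B y -> exists2 x, A x & f x = y) ->
  forall u, seqs_on B u -> exists2 s, seqs_on A s & map f s = u.
Proof.
move=> fAB; elim=> [|y u IH] uB; first by exists [::].
have [x Ax fx] := fAB y (uB y (mem_head _ _)).
have [|s sA fs] := IH; first by move=> z zu; apply: uB; rewrite inE zu orbT.
exists (x :: s); last by rewrite /= fx fs.
by move=> z; rewrite inE => /orP[/eqP->//|/sA].
Qed.

(* The letter [k a] of B is coded by the word [:: a; a] over A. *)
Lemma seqs_on_setU_surj {T : choiceType} (A B : set T) (g : T -> seq T)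
    (k : T -> T) :
  A !=set0 -> B `<=` k @` A ->
  (forall s, s != [::] -> seqs_on A s -> exists2 x, A x & g x = s) ->
  exists h : T -> seq T,
    forall u, seqs_on (A `|` B) u -> exists2 x, A x & h x = u.
Proof.
move=> [a0 Aa0] BkA gA.
pose decode s := match s with [:: a] => a | a :: _ => k a | _ => a0 end.
have surj y : (A `|` B) y -> exists2 x, A x & decode (g x) = y.
  move=> [Ay|/BkA[a Aa <-]].
    have [|x Ax gx] := gA [:: y] isT; last by exists x; rewrite ?gx.
    by move=> z; rewrite inE => /eqP->.
  have [|x Ax gx] := gA [:: a; a] isT; last by exists x; rewrite ?gx.
  by move=> z; rewrite !inE => /orP[]/eqP->.
(* Only nonempty words have codes in [g], so [u] is coded as [a0 :: u] and the first letter is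
   dropped after decoding. *)
exists (fun x => behead (map (decode \o g) (g x))) => u uAB.
have [|s sA su] := seqs_on_map_surj _ _ _ surj (a0 :: u).
  by move=> z; rewrite inE => /orP[/eqP->|/uAB//]; left.
have [|x Ax gx] := gA s _ sA; first by case: s su {sA}.
by exists x => //; rewrite gx su.
Qed.

(* Zorn on the relations [G] coding the nonempty words over their field [A] by letters
   of [A]: if [~` A] embeds in [A], then [G] codes the words over the whole type;
   otherwise [~` A] contains a copy of [A] into which [G] can be extended. *)
Lemma card_le_seq {T : choiceType} : infinite_set [set: T] ->
  ([set: seq T] #<= [set: T])%card.
Proof.
move=> Tinf.
pose fld (G : set (seq T * T)) :=
  [set a | exists s x, G (s, x) /\ a \in x :: s].
pose P G := (forall s s' x, G (s, x) -> G (s', x) -> s = s') /\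
  (forall s, s != [::] -> seqs_on (fld G) s -> exists x, G (s, x)).
have [|G [[Ginj Gtot] Gmax]] := @Zorn_bigcup _ P.
  move=> F FP Ftot; split=> [s s' x [G FG Gs] [G' FG' Gs']|].
    have [/(_ _ Gs) ?|/(_ _ Gs') ?] := Ftot _ _ FG FG'.
      exact: (FP _ FG').1 Gs'.
    exact: (FP _ FG).1 Gs _.
  move=> s s0 sF.
  (* A word has finitely many letters and [F] is a chain, so all of them lie in the field of a
     single member; induction on the word. *)
  suff [G FG sG] : exists2 G, F G & seqs_on (fld G) s.
    by have [x Gx] := (FP _ FG).2 s s0 sG; exists x, G.
  have fldS G G' : G `<=` G' -> fld G `<=` fld G'.
    by move=> GG' a [t [x [/GG' ? ?]]]; exists t, x.
  elim: s s0 sF => // a s IH _ sF.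
  have [t [x [[G FG Gtx] atx]]] := sF a (mem_head _ _).
  have [s0|s0] := eqVneq s [::].
    by exists G => // b; rewrite s0 inE => /eqP->; exists t, x.
  have [|G' FG' sG'] := IH s0.
    by move=> b bs; apply: sF; rewrite inE bs orbT.
  have [GG'|G'G] := Ftot _ _ FG FG'.
    exists G' => // b; rewrite inE => /orP[/eqP->|/sG'//].
    by apply: (fldS _ _ GG'); exists t, x.
  exists G => // b; rewrite inE => /orP[/eqP->|/sG'/(fldS _ _ G'G)//].
  by exists t, x.
set A := fld G in Gtot.
have noext (B : set T) (h : T -> seq T) : B `<=` ~` A ->
    ~ (forall u, seqs_on (A `|` B) u -> exists2 y, B y & h y = u).
  move=> BA hB; pose E := [set p : seq T * T |
    [/\ B p.2, h p.2 = p.1 & seqs_on (A `|` B) p.1]].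
  have fldGE a : fld (G `|` E) a -> (A `|` B) a.
    move=> [s [x [[Gsx|[/= Bx _ sAB]] axs]]]; first by left; exists s, x.
    by move: axs; rewrite inE => /orP[/eqP->|/sAB//]; right.
  apply: (Gmax (G `|` E)).
    split; first by left.
    have [//|y By hy] := hB [::].
    move=> /(_ ([::], y)) sub; apply: (BA y By); exists [::], y.
    by split; [apply: sub; right; split | exact: mem_head].
  split=> [s s' x [Gs|[/= Bx <- _]] [Gs'|[/= Bx' <- _]]//|s _ sF].
  - exact: Ginj Gs'.
  - by case: (BA x Bx'); exists s, x; rewrite mem_head.
  - by case: (BA x Bx); exists s', x; rewrite mem_head.
  have sAB : seqs_on (A `|` B) s by move=> a /sF/fldGE.
  by have [y By hy] := hB s sAB; exists y; right; split.
have [A0|/set0P[a0 Aa0]] := eqVneq A set0.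
  exfalso.
  have [|num numP] := card_le_surj _ (iffLR (infiniteP _) Tinf); first by exists 0%N.
  have /choice[e eK] n : exists x, num x = n by have [x _ <-] := numP n I; exists x.
  pose h y := map e (odflt [::] (unpickle (num y))).
  apply: (noext (range e) h) => [y _|u]; first by rewrite A0.
  rewrite A0 set0U => uB.
  have [|s _ <-] := seqs_on_map_surj e setT (range e) _ u uB.
    by move=> y [n _ <-]; exists n.
  by exists (e (pickle s)); [exists (pickle s)|rewrite /h eK pickleK].
pose g x := xget [::] [set s | G (s, x)].
have gA s : s != [::] -> seqs_on A s -> exists2 x, A x & g x = s.
  move=> s0 sA; have [x Gsx] := Gtot s s0 sA.
  exists x; first by exists s, x; rewrite mem_head.
  by rewrite /g; case: xgetP => [s' -> /Ginj|/(_ s)//]; exact.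
have [CA|AC] := card_le_total (~` A) A.
  have [k Ck] : exists k : T -> T, ~` A `<=` k @` A.
    have [C0|/set0P Cn0] := eqVneq (~` A) set0; first by exists id; rewrite C0.
    have [k kC] := card_le_surj Cn0 CA.
    by exists k => x /kC[y Ay <-]; exists y.
  have [|h hA] := seqs_on_setU_surj A _ g k _ Ck gA; first by exists a0.
  apply: (card_le_rel _ _ (fun s x => h x = s)) => [s _|x x' y _ _ <- <-//].
  have [|x _ hx] := hA s; first by rewrite setUv.
  by exists x.
(* [k] is a section over [A] of a map [g'] from the complement onto [A]. A word coded by [x] in [A]
   gets the fresh code [k x], against [noext]. *)
have [|g' g'A] := card_le_surj _ AC; first by exists a0.
have /choice[k kA] x : exists y, A x -> ~ A y /\ g' y = x.
  have [/g'A[y ? ?]|nAx] := pselect (A x); last by exists x.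
  by exists y.
exfalso.
have [||h hA] := seqs_on_setU_surj A (k @` A) g k _ _ gA => //;
  first by exists a0.
apply: (noext (k @` A) (h \o g')) => [_ [x Ax <-]|u /hA[x Ax <-]].
  by have [] := kA x Ax.
exists (k x); first by exists x.
by rewrite /= (kA x Ax).2.
Qed.

(** * Cylinders *)

Lemma eq_mkseqP {T : Type} (x y : nat -> T) (n : nat) :
  mkseq x n = mkseq y n <-> forall i, (i < n)%N -> x i = y i.
Proof.
split=> [E i ltin|E].
  by rewrite -(nth_mkseq (x i) x ltin) E nth_mkseq.
apply: (@eq_from_nth _ (x 0%N)) => [|i]; rewrite !size_mkseq// => ltin.
by rewrite !nth_mkseq ?E.
Qed.

Definition cylinder {T : Type} (s : seq T) : set (nat -> T) :=
  [set x | mkseq x (size s) = s].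

Lemma cylinder_mkseq {T : Type} (x y : nat -> T) (n : nat) :
  cylinder (mkseq x n) y <-> forall i, (i < n)%N -> y i = x i.
Proof. by rewrite /cylinder/= size_mkseq eq_mkseqP. Qed.

Lemma cylinder_mkseq_self {T : Type} (x : nat -> T) (n : nat) :
  cylinder (mkseq x n) x.
Proof. exact/cylinder_mkseq. Qed.

(** The filter generated by the cylinders around [x] converges in each coordinate, hence in the
    product. Conversely, a cylinder is a finite intersection of preimages of open singletons under
    projections. *)
Lemma nbhs_prod_discreteP {D : discreteTopologicalType}
    (x : prod_topology (fun _ : nat => D)) (A : set (nat -> D)) :
  nbhs x A <-> exists n, cylinder (mkseq x n) `<=` A.
Proof.
split=> [|[n xA]].
  pose F : set_system (nat -> D) := [set B | exists n, cylinder (mkseq x n) `<=` B].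
  have cylW m n : (m <= n)%N -> cylinder (mkseq x n) `<=` cylinder (mkseq x m).
    move=> mn y /cylinder_mkseq xy; apply/cylinder_mkseq => i im.
    exact/xy/(leq_trans im).
  have FF : Filter F.
    split=> [|B C [m mB] [n nC]|B C BC [n nB]].
    - by exists 0%N.
    - exists (maxn m n) => y xy; split.
        by apply: mB; apply: cylW xy; exact: leq_maxl.
      by apply: nC; apply: cylW xy; exact: leq_maxr.
    - by exists n; apply: subset_trans nB BC.
  suff : F --> x by apply.
  apply/cvg_sup => i B; rewrite nbhsE => -[_ [[C _ <-] /= Cx] CB].
  exists i.+1 => y /cylinder_mkseq xy; apply: CB => /=.
  by rewrite xy.
apply: (@filterS _ _ (nbhs_filter x) _ _ xA).
elim: n {xA} => [|n IH].
  by apply: (filterE (nbhs_filter x)) => y; exact/cylinder_mkseq.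
have xn : nbhs x (proj n @^-1` [set x n]).
  apply: proj_continuous; rewrite nbhsE; exists [set x n] => //.
  by split=> //; exact: discrete_open.
apply: filterS (filterI IH xn) => y [/cylinder_mkseq xy yn].
apply/cylinder_mkseq => i; rewrite ltnS leq_eqVlt => /predU1P[->//|].
exact: xy.
Qed.

(** * The first-difference metric *)

(* The parameters [R] and [d0] only serve to attach a metric and a base point
   canonically to the sequences over [D]. *)
Definition metric_seqs (R : realType) (D : choiceType) (d0 : D) : Type :=
  nat -> D.

HB.instance Definition _ (R : realType) (D : choiceType) (d0 : D) :=
  Choice.copy (metric_seqs R D d0) (nat -> D).
HB.instance Definition _ (R : realType) (D : choiceType) (d0 : D) :=
  isPointed.Build (metric_seqs R D d0) (fun=> d0).

Section FirstDifference.
Local Open Scope ring_scope.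

Lemma neq_fun_exists {T : Type} {U : eqType} (x y : T -> U) :
  x <> y -> exists n, x n != y n.
Proof.
move=> xy; apply: contrapT => nE; apply: xy; apply/funext => n.
by apply/eqP; apply: contrapT => xyn; apply: nE; exists n; apply/negP.
Qed.

(** The shift [.+1] keeps the distance positive for sequences that differ at index 0, where the
    inverse of 0 would be 0. *)
Definition first_diff_dist (R : realType) {D : eqType} (x y : nat -> D) : R :=
  if pselect (x = y) is right xy then
    (ex_minn (neq_fun_exists _ _ xy)).+1%:R^-1
  else 0.

Lemma first_diff_dist_cases (R : realType) {D : eqType} (x y : nat -> D) :
  x = y /\ first_diff_dist R x y = 0 \/
  exists n, [/\ x n != y n, (forall i, (i < n)%N -> x i = y i)
             & first_diff_dist R x y = n.+1%:R^-1].
Proof.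
rewrite /first_diff_dist; case: pselect => [->|xy]; first by left.
right; case: ex_minnP => n xyn nmin; exists n; split=> // i.
by rewrite ltnNge => /negP ni; apply/eqP/contraT => /nmin.
Qed.

Lemma first_diff_dist_lt (R : realType) {D : eqType} (x y : nat -> D) (n : nat) :
  first_diff_dist R x y < n.+1%:R^-1 <-> forall i, (i <= n)%N -> x i = y i.
Proof.
have [[-> ->]|[m [xym mmin ->]]] := first_diff_dist_cases R x y.
  by rewrite invr_gt0 ltr0n.
rewrite ltf_pV2 ?posrE ?ltr0n// ltr_nat ltnS; split=> [nm i ni|xyn].
  exact/mmin/(leq_ltn_trans ni).
by rewrite ltnNge; apply/negP => /xyn/eqP; rewrite (negbTE xym).
Qed.

Lemma first_diff_distxx (R : realType) {D : eqType} (x : nat -> D) :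
  first_diff_dist R x x = 0.
Proof.
by have [[]|[n [/eqP]]] := first_diff_dist_cases R x x.
Qed.

Lemma first_diff_dist_eq0 (R : realType) {D : eqType} (x y : nat -> D) :
  first_diff_dist R x y = 0 -> x = y.
Proof.
have [[]//|[n [_ _ ->]]] := first_diff_dist_cases R x y.
by move/eqP; rewrite invr_eq0 pnatr_eq0.
Qed.

Lemma first_diff_dist_ge0 (R : realType) {D : eqType} (x y : nat -> D) :
  0 <= first_diff_dist R x y.
Proof.
by have [[_ ->]|[n [_ _ ->]]] := first_diff_dist_cases R x y.
Qed.

(** A strict inequality is absurd: the smaller distance would force agreement at the very index that
    determines the larger one. *)
Lemma first_diff_dist_sym (R : realType) {D : eqType} (x y : nat -> D) :
  first_diff_dist R x y = first_diff_dist R y x.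
Proof.
wlog: x y / first_diff_dist R x y < first_diff_dist R y x => [wl|].
  by apply/eqP; rewrite eq_le !leNgt; apply/andP; split; apply/negP => /[dup];
    move=> /wl->; rewrite ltxx.
have [[_ ->]|[n [yxn _ ->]]] := first_diff_dist_cases R y x.
  by rewrite ltNge first_diff_dist_ge0.
move/first_diff_dist_lt/(_ n (leqnn n))/eqP.
by rewrite eq_sym (negbTE yxn).
Qed.

(** Ultrametric argument: if [x] and [z] first differ at [n], then [y] differs from one of them at
    or before [n], so one summand alone is at least 1/(n+1). *)
Lemma first_diff_dist_triangle (R : realType) {D : eqType} (y x z : nat -> D) :
  first_diff_dist R x z <= first_diff_dist R x y + first_diff_dist R y z.
Proof.
have [[_ ->]|[n [xzn _ ->]]] := first_diff_dist_cases R x z.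
  by rewrite addr_ge0 ?first_diff_dist_ge0.
have [xy|] := ltP (first_diff_dist R x y) n.+1%:R^-1; last first.
  by move/le_trans; apply; rewrite lerDl first_diff_dist_ge0.
have [yz|] := ltP (first_diff_dist R y z) n.+1%:R^-1; last first.
  by move/le_trans; apply; rewrite lerDr first_diff_dist_ge0.
move: xzn; rewrite (iffLR (first_diff_dist_lt _ _ _ _) xy)//.
by rewrite (iffLR (first_diff_dist_lt _ _ _ _) yz)// eqxx.
Qed.

End FirstDifference.

HB.instance Definition _ (R : realType) (D : choiceType) (d0 : D) :=
  isMetric.Build R (metric_seqs R D d0) (@first_diff_distxx R D)
    (@first_diff_dist_eq0 R D) (@first_diff_dist_sym R D)
    (@first_diff_dist_triangle R D).

Lemma ball_metric_seqs (R : realType) {D : choiceType} (d0 : D)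
    (x : metric_seqs R D d0) (n : nat) :
  ball x (n.+1%:R^-1 : R)%R = cylinder (mkseq x n.+1).
Proof.
rewrite ballEmdist; apply/seteqP; split=> y.
  by move=> /first_diff_dist_lt xy; apply/cylinder_mkseq => i /xy.
by move=> /cylinder_mkseq xy; apply/first_diff_dist_lt => i /xy.
Qed.

Lemma pos_invn_lt {R : realType} (e : R) : (0 < e)%R -> exists n, (n.+1%:R^-1 < e)%R.
Proof.
move=> e0; exists (Num.truncn e^-1)%R; rewrite invf_plt ?posrE ?ltr0n//.
by rewrite -truncn_le_nat.
Qed.

Lemma nbhs_metric_seqsP (R : realType) {D : choiceType} (d0 : D)
    (x : metric_seqs R D d0) (A : set (nat -> D)) :
  nbhs x A <-> exists n, cylinder (mkseq x n) `<=` A.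
Proof.
split=> [/nbhs_ballP[e /= e0]|[n xA]].
  have [n /ltW ne] := pos_invn_lt e e0.
  by move=> xA; exists n.+1; rewrite -ball_metric_seqs; apply/(subset_trans _ xA)/le_ball.
apply/nbhs_ballP; exists (n.+1%:R^-1)%R; first by rewrite /= invr_gt0 ltr0n.
rewrite ball_metric_seqs => y /cylinder_mkseq xy; apply/xA/cylinder_mkseq => i /ltnW.
exact: xy.
Qed.

Lemma metric_seqs_complete (R : realType) {D : choiceType} (d0 : D)
    (F : set_system (metric_seqs R D d0)) :
  ProperFilter F -> cauchy F -> cvg F.
Proof.
move=> FF Fc.
have /choice[c cF] n : exists x, F (cylinder (mkseq x n.+1)).
  have /cauchyP/(_ (n.+1%:R^-1)%R)[|x] := Fc; first by rewrite invr_gt0 ltr0n.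
  by rewrite ball_metric_seqs => ?; exists x.
(* Diagonal limit: [F]-almost every sequence agrees with [c n] through index [n]. *)
pose y : metric_seqs R D d0 := fun n => c n n.
apply/cvg_ex; exists y => A /nbhs_metric_seqsP[n nA]; apply: (@filterS _ F _ _ _ nA).
elim: n {nA} => [|n IH]; first by apply: (@filterE _ F _) => z; exact/cylinder_mkseq.
apply: filterS (filterI IH (cF n)) => z [/cylinder_mkseq yz /cylinder_mkseq cz].
apply/cylinder_mkseq => i; rewrite ltnS leq_eqVlt => /predU1P[->|/yz//].
exact: cz.
Qed.

HB.instance Definition _ (R : realType) (D : choiceType) (d0 : D) :=
  Uniform_isComplete.Build (metric_seqs R D d0) (@metric_seqs_complete R D d0).

(** * Weight, trees of open sets and branches *)

(** There are at most as many cylinders as finite words, hence as letters. They form a least basis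
    because any basis has a nonempty member inside each one-letter cylinder, and these cylinders are
    disjoint. *)
Lemma weight_metric_seqs (R : realType) {D : choiceType} (d0 : D) :
  infinite_set [set: D] -> weight_le (metric_seqs R D d0) D.
Proof.
move=> Dinf; pose B : set (set (metric_seqs R D d0)) := range cylinder.
have BD : (B #<= [set: D])%card.
  exact: card_le_trans (card_image_le _ _) (card_le_seq Dinf).
exists B => //; split; first split.
- move=> _ [s _ <-]; rewrite openE => x xs.
  by apply/nbhs_metric_seqsP; exists (size s); rewrite xs.
- move=> x A /nbhs_metric_seqsP[n nA]; exists (cylinder (mkseq x n)) => //.
  by split; [exists (mkseq x n) | exact: cylinder_mkseq_self].
- move=> B' [_ B'x]; apply: card_le_trans BD _.
  apply: (card_le_rel _ _ (fun d V => V !=set0 /\ V `<=` cylinder [:: d])).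
    move=> d _; pose x : metric_seqs R D d0 := fun=> d.
    have /B'x[V [B'V Vx] Vd] : nbhs x (cylinder [:: d]).
      by apply/nbhs_metric_seqsP; exists 1%N.
    by exists V => //; split=> //; exists x.
  move=> d d' V _ _ [[x Vx] Vd] [_ Vd'].
  by case: (Vd x Vx) => <-; case: (Vd' x Vx) => <-.
Qed.

(** Both topologies have the cylinders of initial segments as neighbourhood bases, so nowhere
    density means the same in both. *)
Lemma baire_prod_of_complete_metric (R : realType) (D : discreteTopologicalType)
    (I : set (set nat)) :
  infinite_set [set: D] ->
  (forall X : completeMetricType R, weight_le X D -> baire_ideal I X) ->
  baire_ideal I (prod_topology (fun _ : nat => D)).
Proof.
move=> Dinf baire F Fnwd Fmono; have [d0 _] := infinite_setN0 Dinf.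
have nbhs_eq :
    (@nbhs _ (prod_topology (fun _ : nat => D)) : (nat -> D) -> set_system (nat -> D))
    = @nbhs _ (metric_seqs R D d0).
  apply/funext => x; apply/seteqP; split=> A.
    by move=> /nbhs_prod_discreteP/(nbhs_metric_seqsP R d0).
  by move=> /nbhs_metric_seqsP/nbhs_prod_discreteP.
apply: (baire (metric_seqs R D d0)) => //; first exact: weight_metric_seqs.
move=> a /Fnwd; rewrite /nowhere_dense /interior /closure.
by rewrite nbhs_eq.
Qed.

Lemma nowhere_dense_prod_discrete {D : discreteTopologicalType} (A : set (nat -> D)) :
  (forall s : seq D, exists2 t, prefix s t & forall x, cylinder t x -> ~ A x) ->
  @nowhere_dense (prod_topology (fun _ : nat => D)) A.
Proof.
move=> dense; apply/seteqP; split=> // x /nbhs_prod_discreteP[n xA].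
have [t /prefixP[u tE] tA] := dense (mkseq x n).
(* [y] is a continuation of [t], padded with [x 0]; it lies near [x], while its neighbourhood
   [cylinder t] misses [A]. *)
pose y := nth (x 0%N) t.
have yt : mkseq y (size t) = t by exact: mkseq_nth.
have /xA : cylinder (mkseq x n) y.
  apply/cylinder_mkseq => i ltin.
  by rewrite /y tE nth_cat size_mkseq ltin nth_mkseq.
case/(_ (cylinder t)) => [|z [Az tz]]; last exact: tA tz Az.
by apply/nbhs_prod_discreteP; exists (size t); rewrite yt.
Qed.

Lemma branch_of_baire_prod (D : discreteTopologicalType) (I : set (set nat)) :
  baire_ideal I (prod_topology (fun _ : nat => D)) ->
  forall f : seq D -> set (set nat), monotonic_into I f ->
    (forall s, hereditary (f s)) ->
    (forall s, I = \bigcup_(t in [set t | prefix s t]) f t) ->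
    exists sigma : nat -> D, branch_covers I f sigma.
Proof.
move=> baire f [fI _] fher fcof.
pose F (a : set nat) : set (nat -> D) := [set x | forall k, ~ f (mkseq x k) a].
have /eqP/setTPn[x xF] : \bigcup_(a in I) F a <> [set: nat -> D].
  (* Heredity of [f] makes [F] monotone. Every [s] extends to some [t] with [a] in [f t], and the
     cylinder of [t] misses [F a]. *)
  apply: baire => [a Ia|a b _ _ ab x Fx k /(fher _ _ _ ab)]; last exact: Fx.
  apply: nowhere_dense_prod_discrete => s.
  have [t st fta] : (\bigcup_(t in [set t | prefix s t]) f t) a by rewrite -fcof.
  by exists t => // x xt /(_ (size t)); rewrite xt.
exists x; apply/seteqP; split=> [a [k _ /fI]//|a Ia].
apply: contrapT => nfa; apply: xF; exists a => // k fka.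
by apply: nfa; exists k.
Qed.

(** * Open trees in complete metric spaces *)

Lemma nowhere_dense_avoid {X : topologicalType} (A U : set X) :
  nowhere_dense A -> open U -> U !=set0 -> (U `\` closure A) !=set0.
Proof.
move=> Anwd Uo [x Ux]; apply: contrapT => UA.
suff : interior (closure A) x by rewrite Anwd.
rewrite /interior nbhsE; exists U => // y Uy.
by apply: contrapT => Ay; apply: UA; exists y.
Qed.

Lemma basis_shrink {R : realType} {X : metricType R} (B : set (set X)) (U : set X)
    (x : X) (e : R) :
  basis B -> open U -> U x -> (0 < e)%R ->
  exists V, [/\ B V, V x, closure V `<=` U & V `<=` ball x e].
Proof.
move=> [_ Bx] Uo Ux e0.
have /uniform_regular[W xW WU] : nbhs x U by apply: open_nbhs_nbhs.
have /Bx[V [BV Vx] VW] : nbhs x (W `&` ball x e).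
  by apply: filterI => //; exact: nbhsx_ballx.
exists V; split=> // [|y /VW[]//].
by apply: subset_trans WU; apply: closureS => y /VW[].
Qed.

(** The admissible children [V] of a node [U] at depth [n]. Membership in [B] lets letters index
    them; the closure and radius conditions make branches meet by completeness. *)
Definition refines {R : realType} {X : metricType R} (B : set (set X)) (n : nat)
    (U V : set X) : Prop :=
  [/\ B V, V !=set0, closure V `<=` U &
      exists x, V `<=` ball x (n.+1%:R^-1 : R)%R].

(* The bound on the weight supplies a surjection from the letters onto [B]. *)
Lemma open_tree_exists {R : realType} {X : completeMetricType R} {D : Type}
    (B : set (set X)) :
  basis B -> (B #<= [set: D])%card ->
  exists U : seq D -> set X,
    [/\ forall s, open (U s), forall s, U s !=set0,
        forall s d, refines B (size s) (U s) (U (rcons s d)) &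
        forall s V, refines B (size s) (U s) V -> exists d, U (rcons s d) = V].
Proof.
move=> Bb BD.
have shrink n U x : open U -> U x -> exists2 V, refines B n U V & V x.
  move=> Uo Ux; have [|V [BV Vx VU Vb]] := basis_shrink B U x (n.+1%:R^-1 : R)%R Bb Uo Ux.
    by rewrite invr_gt0 ltr0n.
  by exists V => //; split=> //; exists x.
have Bn0 : B !=set0.
  by have [|V [BV _ _ _] _] := shrink 0%N [set: X] point openT; last by exists V.
have [g gB] := card_le_surj Bn0 BD.
(* [def p] is the fallback child for letters whose set under [g] is not admissible; thus every
   letter yields a child. *)
have /choice[def defP] (p : nat * set X) :
    exists V, (exists V', refines B p.1 p.2 V') -> refines B p.1 p.2 V.
  have [[V ?]|nV] := pselect (exists V', refines B p.1 p.2 V'); first by exists V.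
  by exists set0 => /nV.
(* The state carries the depth, which fixes the radius allowed for the next child. *)
pose step (p : nat * set X) d :=
  (p.1.+1, if pselect (refines B p.1 p.2 (g d)) then g d else def p).
pose node s := foldl step (0%N, [set: X]) s.
have node1 s : (node s).1 = size s.
  elim/last_ind: s => // s d IH.
  by rewrite /node foldl_rcons size_rcons /= -IH.
have nodeS s d : (node (rcons s d)).2 =
    if pselect (refines B (size s) (node s).2 (g d)) then g d else def (node s).
  by rewrite /node foldl_rcons /= -node1.
have openn0 s : open (node s).2 /\ (node s).2 !=set0 ->
    forall d, refines B (size s) (node s).2 (node (rcons s d)).2.
  move=> [Uo [x Ux]] d; rewrite nodeS; case: pselect => [|?] //=.
  rewrite -node1; apply: defP.
  by have [V VU _] := shrink (node s).1 (node s).2 x Uo Ux; exists V.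
have inv s : open (node s).2 /\ (node s).2 !=set0.
  elim/last_ind: s => [|s d IH]; first by split; [exact: openT | exists point].
  by have [/(Bb.1 _) ? ? _ _] := openn0 s IH d.
exists (fun s => (node s).2); split=> [s|s|s d|s V UV].
- exact: (inv s).1.
- exact: (inv s).2.
- exact: openn0.
have [BV _ _ _] := UV; have [d _ gd] := gB V BV.
by exists d; rewrite nodeS gd; case: pselect.
Qed.

Lemma prefix_decreasing {T : eqType} {X : Type} (U : seq T -> set X) :
  (forall s d, U (rcons s d) `<=` U s) ->
  forall s t, prefix s t -> U t `<=` U s.
Proof.
move=> Udecr s _ /prefixP[u ->]; elim/last_ind: u => [|u d IH].
  by rewrite cats0.
by rewrite -rcons_cat; apply: subset_trans IH; exact: Udecr.
Qed.

Lemma prefix_mkseq {T : eqType} (x : nat -> T) (m n : nat) :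
  (m <= n)%N -> prefix (mkseq x m) (mkseq x n).
Proof.
move=> /subnK <-; elim: (n - m)%N => [|k IH]; first exact: prefix_refl.
by rewrite addSn mkseqS; apply: (prefix_trans IH); exact: prefix_rcons.
Qed.

(** The sets along the branch generate a Cauchy filter, their radii tending to 0. Its limit lies in
    the closure of each of them, and the closure of each set is contained in the preceding one. *)
Lemma branch_inter {R : realType} {X : completeMetricType R} {D : eqType}
    (B : set (set X)) (U : seq D -> set X) (sigma : nat -> D) :
  (forall s, U s !=set0) ->
  (forall s d, refines B (size s) (U s) (U (rcons s d))) ->
  \bigcap_k U (mkseq sigma k) !=set0.
Proof.
move=> Un0 Uref.
have Umono : forall s t, prefix s t -> U t `<=` U s.
  apply: prefix_decreasing => s d.
  by have [_ _ + _] := Uref s d; apply: subset_trans; exact: subset_closure.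
have Usig m n : (m <= n)%N -> U (mkseq sigma n) `<=` U (mkseq sigma m).
  by move=> mn; exact/Umono/prefix_mkseq.
pose F : set_system X := [set A | exists k, U (mkseq sigma k) `<=` A].
have FF : ProperFilter F.
  split=> [[k]|]; first by have [x /[swap]/[apply]] := Un0 (mkseq sigma k).
  split=> [|A A' [m mA] [n nA']|A A' AA' [n nA]].
  - by exists 0%N.
  - exists (maxn m n) => x xU; split.
      by apply: mA; apply: Usig xU; exact: leq_maxl.
    by apply: nA'; apply: Usig xU; exact: leq_maxr.
  - by exists n; apply: subset_trans nA AA'.
have /cauchy_cvg/cvg_ex[x Fx] : cauchy F.
  apply/cauchy_exP => e e0; have [n /ltW ne] := pos_invn_lt e e0.
  have [_ _ _ [x xU]] := Uref (mkseq sigma n) (sigma n).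
  exists x, n.+1; rewrite mkseqS; apply: subset_trans xU _.
  by rewrite size_mkseq; exact: le_ball.
exists x => k _.
have [_ _ + _] := Uref (mkseq sigma k) (sigma k); apply; rewrite -mkseqS.
move=> W /Fx[j jW]; have [y yU] := Un0 (mkseq sigma (maxn j k.+1)).
exists y; split; first by apply: Usig yU; exact: leq_maxr.
by apply: jW; apply: Usig yU; exact: leq_maxl.
Qed.

Lemma baire_complete_metric_of_branch (R : realType) (D : discreteTopologicalType)
    (I : set (set nat)) (X : completeMetricType R) :
  [set: D] !=set0 -> hereditary I -> weight_le X D ->
  (forall f : seq D -> set (set nat), monotonic_into I f ->
    (forall s, hereditary (f s)) ->
    (forall s, I = \bigcup_(d in [set: D]) f (rcons s d)) ->
    (forall s, f s = \bigcap_(d in [set: D]) f (rcons s d)) ->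
    exists sigma : nat -> D, branch_covers I f sigma) ->
  baire_ideal I X.
Proof.
move=> [d0 _] Iher [B [Bb _] BD] branch F Fnwd Fmono FX.
have [U [Uo Un0 Uref Usurj]] := open_tree_exists B Bb BD.
have Udecr s d : U (rcons s d) `<=` U s.
  by have [_ _ + _] := Uref s d; apply: subset_trans; exact: subset_closure.
have child s (W : set X) x : open W -> W `<=` U s -> W x ->
    exists2 d, U (rcons s d) `<=` W & U (rcons s d) x.
  move=> Wo WU Wx.
  have [|V [BV Vx VW Vb]] :=
      basis_shrink B W x ((size s).+1%:R^-1 : R)%R Bb Wo Wx.
    by rewrite invr_gt0 ltr0n.
  have [|d UV] := Usurj s V.
    by split=> //; [exists x | exact: subset_trans WU | exists x].
  by exists d; rewrite UV//; apply: subset_trans VW; exact: subset_closure.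
pose f s : set (set nat) := [set a | I a /\ forall x, U s x -> ~ F a x].
have fmono s t : prefix s t -> f s `<=` f t.
  move=> st a [Ia sa]; split=> // x /(prefix_decreasing U Udecr s t st).
  exact: sa.
have [||s|s|sigma sigmaI] := branch f.
- by split=> // s a [].
- move=> s a b ba [Ia sa]; have Ib := Iher _ _ ba Ia.
  by split=> // x /sa nFx /(Fmono _ _ Ib Ia ba).
(* [U s] minus the closure of [F a] is open and nonempty, so it contains a child, which avoids
   [F a]. *)
- apply/seteqP; split=> [a Ia|a [d _ []//]].
  have [x [Ux Fx]] := nowhere_dense_avoid _ _ (Fnwd a Ia) (Uo s) (Un0 s).
  have [||d dW _] := child s (U s `\` closure (F a)) x _ _ (conj Ux Fx).
  + by apply: openI => //; exact/closed_openC/closed_closure.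
  + exact: subIsetl.
  exists d => //; split=> // y /dW[_ nFy] Fy.
  exact/nFy/subset_closure.
(* The children cover [U s]: if all of them avoid [F a], so does [U s]. The letter [d0] gives
   membership in [I]. *)
- apply/seteqP; split=> [a fa d _|a fa].
    by apply: fmono fa; exact: prefix_rcons.
  split=> [|x Ux]; first by have [] := fa d0 Logic.I.
  have [d _ dx] := child s (U s) x (Uo s) (@subset_refl _ _) Ux.
  by have [_ +] := fa d Logic.I; exact.
have [x xU] := branch_inter B U sigma Un0 Uref.
have [a Ia Fax] : (\bigcup_(a in I) F a) x by rewrite FX.
have [k _ [_ +]] : (\bigcup_k f (mkseq sigma k)) a by rewrite sigmaI.
by move=> /(_ x); apply => //; exact: xU.
Qed.

Theorem theorem3p1 (R : realType) (D : discreteTopologicalType)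
    (D_infinite : infinite_set [set: D]) (I : set (set nat)) (I_ideal : ideal I) :
  [<->
    forall X : completeMetricType R, weight_le X D -> baire_ideal I X;
    baire_ideal I (prod_topology (fun _ : nat => D));
    forall f : seq D -> set (set nat), monotonic_into I f ->
      (forall s, hereditary (f s)) ->
      (forall s, I = \bigcup_(t in [set t | prefix s t]) f t) ->
      exists sigma : nat -> D, branch_covers I f sigma;
    forall f : seq D -> set (set nat), monotonic_into I f ->
      (forall s, hereditary (f s)) ->
      (forall s, I = \bigcup_(d in [set: D]) f (rcons s d)) ->
      (forall s, f s = \bigcap_(d in [set: D]) f (rcons s d)) ->
      exists sigma : nat -> D, branch_covers I f sigma
  ].
Proof.
tfae.
- exact: baire_prod_of_complete_metric.
- exact: branch_of_baire_prod.
(* One-letter extensions of [s] are among its extensions, so covering by the former implies covering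
   by the latter. *)
- move=> branch f fI fher fcup _; apply: branch => // s.
  apply/seteqP; split=> [a|a [t _ /(fI.1 t)]//].
  rewrite {1}(fcup s) => -[d _ fa]; exists (rcons s d) => //=.
  exact: prefix_rcons.
- move=> branch X XD; apply: baire_complete_metric_of_branch XD branch.
    exact: infinite_setN0.
  exact: ideal_hereditary.
Qed.
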